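(* Let $A, B \in \mathbb{R}^{n \times n}$ be given. The pair $(A, B)$ is diagonally Riccati stable if and only if $-(A\circ S_{11} + B \circ S_{12})$ is a P-matrix for all matrices $S = \begin{pmatrix} S_{11} & S_{12}\\ S_{12}^T & S_{22}\end{pmatrix} \in \mathrm{Sym}(2n,\mathbb{R})$ (with $n \times n$ blocks) satisfying $S \succeq 0$ and $\mathrm{diag}(S_{11}) = \mathrm{diag}(S_{22}) \gg 0$.
   Context: $M \succ 0$, $M \prec 0$, $M \succeq 0$ mean that the real matrix $M=M^T$ is positive definite, negative definite, positive semi-definite, respectively. A pair $(A,B)$ of matrices in $\mathbb{R}^{n\times n}$ is diagonally Riccati stable if there exist diagonal $P \succ 0$, $Q \succ 0$ in $\mathbb{R}^{n \times n}$ with $A^TP+PA + Q + PBQ^{-1}B^TP \prec 0$. $\mathrm{Sym}(m,\mathbb{R})$ is the space of real symmetric $m \times m$ matrices. For $M \in \mathbb{R}^{n\times n}$, $\mathrm{diag}(M) \in \mathbb{R}^n$ is the vector of diagonal entries of $M$. For $v,w\in\mathbb{R}^n$, $v \gg w$ means $v_i > w_i$ for all $i$. $A \circ B$ denotes the Hadamard (entrywise) product, with $(i,j)$ entry $a_{ij}b_{ij}$. A matrix in $\mathbb{R}^{n\times n}$ is a P-matrix if all of its principal minors are positive (equivalently, a matrix $M$ such that for every non-zero $x\in\mathbb{R}^n$ there is an index $i$ with $x_i(Mx)_i>0$). *)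

(* Defs.v *)
From mathcomp Require Import all_boot all_order all_algebra.
From mathcomp Require Import reals.

Set Implicit Arguments.
Unset Strict Implicit.
Unset Printing Implicit Defensive.

Import Order.TTheory GRing.Theory Num.Theory.
Local Open Scope ring_scope.

Section MatrixNotions.
Variable R : realType.

Definition quad_form (m : nat) (M : 'M[R]_m) (x : 'cV[R]_m) : R :=
  (x^T *m M *m x) 0 0.

Definition posdef (m : nat) (M : 'M[R]_m) : Prop :=
  M^T = M /\ forall x : 'cV[R]_m, x != 0 -> 0 < quad_form M x.

Definition negdef (m : nat) (M : 'M[R]_m) : Prop :=
  M^T = M /\ forall x : 'cV[R]_m, x != 0 -> quad_form M x < 0.

Definition possemidef (m : nat) (M : 'M[R]_m) : Prop :=
  M^T = M /\ forall x : 'cV[R]_m, 0 <= quad_form M x.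

(* Not [diag_mx], which goes from vectors to diagonal matrices. *)
Definition diag_vec (m : nat) (M : 'M[R]_m) : 'cV[R]_m := \col_i M i i.

Definition vec_gt (m : nat) (v w : 'cV[R]_m) : Prop :=
  forall i, v i 0 > w i 0.

Definition hadamard (m p : nat) (A B : 'M[R]_(m, p)) : 'M[R]_(m, p) :=
  map2_mx *%R A B.

Definition principal_submx (m : nat) (M : 'M[R]_m) (I : {set 'I_m}) :
    'M[R]_#|I| :=
  mxsub (@enum_val _ (mem I)) (@enum_val _ (mem I)) M.

Definition P_matrix (m : nat) (M : 'M[R]_m) : Prop :=
  forall I : {set 'I_m}, I != set0 -> 0 < \det (principal_submx M I).

Definition diag_riccati_stable (n : nat) (A B : 'M[R]_n) : Prop :=
  exists P Q : 'M[R]_n,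
    [/\ is_diag_mx P, posdef P, is_diag_mx Q, posdef Q &
        negdef (A^T *m P + P *m A + Q + P *m B *m invmx Q *m B^T *m P)].

End MatrixNotions.

(* Main.v *)
Require Import Defs.
From mathcomp Require Import all_boot all_order all_algebra perm.
From mathcomp Require Import reals.
From mathcomp Require boolp classical_sets topology normedtype derive.
From mathcomp Require Import ring lra.
Import Order.TTheory GRing.Theory Num.Theory.
Local Open Scope ring_scope.

Set Implicit Arguments.
Unset Strict Implicit.
Unset Printing Implicit Defensive.

(** By Schur complement, the Riccati inequality says that the symmetric block
matrix
[[
  N(P, Q) = [ A^T P + P A + Q   P B ]
            [      B^T P        -Q  ]
]]
is negative definite ([negdef_riccati_block]).  It is linear in the diagonals
p of P and q of Q, and pairing it with a symmetric S gives
([trace_riccati_block])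
[[
  tr (N(P, Q) S) = 2 sum_i p_i r_i + sum_i q_i ((S11)_ii - (S22)_ii),
]]
where r_i is the i-th row sum of T(S) = A o S11 + B o S12.  Both implications
evaluate this pairing on positive semidefinite matrices, and the condition on
minors is used through the theorem of Fiedler and Ptak: M is a P-matrix iff
each nonzero x has an index i with x_i (M x)_i > 0
([sign_preserving_P_matrix], [P_matrix_sign_preserving]).

If the pair is stable, x is nonzero and X = diag(x), then replacing each block
of S by X S_ij X keeps S semidefinite, nonzero and with equal diagonals, and
turns r_i into x_i (T(S) x)_i.  The trace against a negative definite matrix
is negative, so sum_i p_i x_i (T(S) x)_i < 0, and some x_i (T(S) x)_i is
negative ([stable_sign_preserving]).

Conversely, a theorem of the alternative for the semidefinite cone
([psd_gordan]) says that if no positive p, q make N(P, Q) negative definite,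
then some semidefinite S of trace 1 has r_i >= 0 and (S11)_ii >= (S22)_ii for
all i.  Let x be the indicator of the indices with (S11)_ii > 0.  Adding a
nonnegative diagonal matrix to S makes its two diagonals equal and positive;
neither this nor the restriction to the support of x affects the row sums
that matter, so x_i (T(S) x)_i >= 0 for every i, against the sign property
([stable_of_sign_preserving]).

The alternative itself is proved by minimising, over the compact set of
semidefinite matrices of trace 1, the squared distance to feasibility
sum_i (tr (F_i S)^-)^2; if the minimum is positive, the negative parts at the
minimiser are the multipliers. *)

(** * P-matrices and the sign property *)

Lemma cvN0_entry (R : realType) n (x : 'cV[R]_n) : x != 0 -> exists i, x i 0 != 0.
Proof.
move=> x0; apply/existsP; apply: contraNT x0; rewrite negb_exists.
move/forallP=> x0; apply/eqP/matrixP=> i j; rewrite ord1 mxE.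
by apply/eqP; have := x0 i; rewrite negbK.
Qed.

Lemma det0_kernel (R : realType) n (M : 'M[R]_n) :
  \det M = 0 -> exists2 x : 'cV[R]_n, x != 0 & M *m x = 0.
Proof.
rewrite -det_tr => /eqP/det0P[v v0 vM]; exists v^T.
  by apply: contra v0 => /eqP e; rewrite -(trmxK v) e trmx0.
by apply: trmx_inj; rewrite trmx_mul trmxK vM trmx0.
Qed.

Definition sign_preserving (R : realType) n (M : 'M[R]_n) : Prop :=
  forall x : 'cV[R]_n, x != 0 -> exists i, 0 < x i 0 * (M *m x) i 0.

(** The determinant of this matrix is the principal minor of [M] on [I], but its
size does not depend on [I]; this makes the multilinearity of the determinant
directly applicable to principal minors. *)
Definition masked (R : realType) n (M : 'M[R]_n) (I : {set 'I_n}) : 'M[R]_n :=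
  \matrix_(i, j) if i \in I then M i j else (i == j)%:R.

(** Rows and columns undergo the same permutation, so the signs cancel. *)
Lemma det_mxsub_inj (R : realType) m n (f : 'I_m -> 'I_n) (M : 'M[R]_n) :
  m = n -> injective f -> \det (mxsub f f M) = \det M.
Proof.
move=> mn; subst m => inj_f.
have -> : mxsub f f M = row_perm (perm inj_f) (col_perm (perm inj_f) M).
  by apply/matrixP=> i j; rewrite !mxE !permE.
rewrite row_permE col_permE !det_mulmx !det_perm odd_permV mulrCA.
by rewrite -signr_addb addbb mulr1.
Qed.

(** Listing the indices of [I] first makes the masked matrix block triangular,
with an identity as its lower block. *)
Lemma det_masked (R : realType) n (M : 'M[R]_n) (I : {set 'I_n}) :
  \det (masked M I) = \det (principal_submx M I).
Proof.
pose f (k : 'I_(#|I| + #|~: I|)) : 'I_n :=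
  match split k with inl a => enum_val a | inr b => enum_val b end.
have fl a : f (lshift _ a) = enum_val a by rewrite /f (unsplitK (inl a)).
have fr b : f (rshift _ b) = enum_val b by rewrite /f (unsplitK (inr b)).
have Ival (a : 'I_#|I|) : enum_val a \in I := enum_valP a.
have Cval (b : 'I_#|~: I|) : enum_val b \in I = false.
  by have := enum_valP b; rewrite inE => /negbTE.
have inj_f : injective f.
  move=> a b; case: (split_ordP a) => a' ->; case: (split_ordP b) => b' ->;
    rewrite ?fl ?fr.
  - by move/enum_val_inj->.
  - by move=> e; have := Ival a'; rewrite e Cval.
  - by move=> e; have := Ival b'; rewrite -e Cval.
  - by move/enum_val_inj->.
rewrite -(det_mxsub_inj (f := f)) //; last by rewrite cardsC card_ord.
set N := mxsub f f _.
have -> : N = block_mx (principal_submx M I) (ursubmx N) 0 1%:M.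
  rewrite -[LHS]submxK; congr block_mx; apply/matrixP=> i j; rewrite !mxE.
  - by rewrite !fl Ival.
  - rewrite fr fl Cval; case: eqP => // e.
    by have := Ival j; rewrite -e Cval.
  - by rewrite !fr Cval (inj_eq enum_val_inj).
by rewrite det_ublock det1 mulr1.
Qed.

Lemma masked_mul (R : realType) n (M : 'M[R]_n) (I : {set 'I_n}) (x : 'cV[R]_n) i :
  (masked M I *m x) i 0 = if i \in I then (M *m x) i 0 else x i 0.
Proof.
rewrite !mxE; case: ifP => iI.
  by apply: eq_bigr => j _; rewrite mxE iI.
rewrite (bigD1 i) //= mxE iI eqxx mul1r big1 ?addr0 // => j ji.
by rewrite mxE iI eq_sym (negbTE ji) mul0r.
Qed.

(** All matrices on the segment from the identity to [M] are nonsingular: at a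
kernel vector [x] of [(1 - t) I + t M], an index with [x_i (M x)_i > 0] gives
[(1 - t) x_i^2 + t x_i (M x)_i > 0].  The determinant is a polynomial in [t]
with value 1 at 0, so it stays positive. *)
Lemma sign_preserving_det_gt0 (R : realType) n (M : 'M[R]_n) :
  sign_preserving M -> 0 < \det M.
Proof.
move=> sM; rewrite ltNge; apply/negP => detM.
pose N : 'M[{poly R}]_n :=
  (1 - 'X)%:M + map_mx (fun a => 'X * a%:P) M.
have evN t : (\det N).[t] = \det ((1 - t)%:M + t *: M).
  rewrite -[LHS]/(horner_eval t _) -det_map_mx; congr (\det _).
  apply/matrixP=> i j; rewrite !mxE /= /horner_eval.
  by rewrite hornerD hornerMn !hornerE.
have [||t /andP[t0 t1]] := @poly_ivt R (- \det N) 0 1; first exact: ler01.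
  rewrite !hornerN !evN subr0 scale0r addr0 det1 subrr scale1r.
  rewrite (_ : 0%:M = 0) ?add0r; first by rewrite oppr_le0 ler01 oppr_ge0.
  by apply/matrixP=> i j; rewrite !mxE mul0rn.
rewrite /root hornerN oppr_eq0 evN => /eqP/det0_kernel[x x0 Nx].
have [i xi] := sM x x0.
have Nxi : (((1 - t)%:M + t *: M) *m x) i 0 = (1 - t) * x i 0 + t * (M *m x) i 0.
  rewrite mulmxDl mul_scalar_mx -scalemxAl.
  by move: (M *m x) => y; rewrite !mxE.
have : x i 0 * (((1 - t)%:M + t *: M) *m x) i 0 = 0 by rewrite Nx mxE mulr0.
rewrite {}Nxi.
have : x i 0 != 0 by apply: contraTneq xi => ->; rewrite mul0r ltxx.
move: (x i 0) ((M *m x) i 0) xi => a b ab a0.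
rewrite (_ : a * _ = (1 - t) * a ^+ 2 + t * (a * b)); last by ring.
have a2 : 0 < a ^+ 2 by rewrite exprn_even_gt0.
move=> e.
have h1 : 0 <= (1 - t) * a ^+ 2 by apply: mulr_ge0; [rewrite subr_ge0|exact: ltW].
have h2 : 0 <= t * (a * b) by apply: mulr_ge0 => //; exact: ltW.
move: t0; rewrite le_eqVlt => /orP[/eqP t0|t0].
  by move: e; rewrite -t0; lra.
by have := mulr_gt0 t0 ab; lra.
Qed.

(** Masking preserves the sign property: an index outside [I] in the support of
[x] contributes [x_i^2], and if there is none, the index given by [M] lies in
[I]. *)
Lemma sign_preserving_P_matrix (R : realType) n (M : 'M[R]_n) :
  sign_preserving M -> P_matrix M.
Proof.
move=> sM I _; rewrite -det_masked; apply: sign_preserving_det_gt0 => x x0.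
have [/existsP[i /andP[iI xi]]|] := boolP [exists i, (i \notin I) && (x i 0 != 0)].
  by exists i; rewrite masked_mul (negbTE iI) -expr2 exprn_even_gt0.
rewrite negb_exists => /forallP xI; have [i xi] := sM x x0.
exists i; rewrite masked_mul; case: ifP => // iI.
have := xI i; rewrite iI /= negbK => /eqP e.
by rewrite e mul0r ltxx in xi.
Qed.

(** Switching on the entries of [d] one at a time: by multilinearity in row [a],
the determinant grows by [d_a] times the minor obtained by also masking row
[a], which is positive by induction. *)
Lemma P_matrix_det_shift_gt0 (R : realType) n (M : 'M[R]_n) (d : 'rV[R]_n) :
  P_matrix M -> (forall i, 0 <= d 0 i) ->
  forall I : {set 'I_n}, 0 < \det (masked (M + diag_mx d) I).
Proof.
move=> PM d0.
have PM0 I : 0 < \det (masked M I).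
  have [->|I0] := eqVneq I set0; last by rewrite det_masked; exact: PM.
  rewrite (_ : masked M set0 = 1%:M) ?det1 ?ltr01 //.
  by apply/matrixP=> i j; rewrite !mxE inE.
pose dK (K : {set 'I_n}) : 'rV[R]_n := \row_i if i \in K then d 0 i else 0.
suff H k (K : {set 'I_n}) : #|K| = k ->
    forall I : {set 'I_n}, 0 < \det (masked (M + diag_mx (dK K)) I).
  have -> : d = dK setT by apply/rowP=> i; rewrite mxE inE.
  exact: (H _ _ erefl).
elim: k K => [|k IH] K.
  move/eqP; rewrite cards_eq0 => /eqP-> I.
  rewrite (_ : diag_mx _ = 0) ?addr0 //.
  by apply/matrixP=> i j; rewrite !mxE inE mul0rn.
move=> cK; have /card_gt0P[a aK] : (0 < #|K|)%N by rewrite cK.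
have cK' : #|K :\ a| = k by move: cK; rewrite (cardsD1 a) aK => -[].
move=> I; have [aI|aI] := boolP (a \in I); last first.
  rewrite (_ : masked _ I = masked (M + diag_mx (dK (K :\ a))) I).
    exact: IH.
  apply/matrixP=> i j; rewrite !mxE; case: ifP => // iI.
  have ia : i != a by apply: contraNneq aI => <-.
  rewrite !in_setD1.
  case: (eqVneq i j) => [<-|_]; last by rewrite !mulr0n.
  by rewrite ia.
rewrite (determinant_multilinear (i0 := a) (b := 1) (c := d 0 a)
   (B := masked (M + diag_mx (dK (K :\ a))) I)
   (C := masked (M + diag_mx (dK (K :\ a))) (I :\ a))).
- by rewrite mul1r ltr_wpDr ?IH // mulr_ge0 // ltW // IH //.
- apply/rowP=> j; rewrite !mxE aI aK !in_setD1 eqxx /= mul0rn addr0 mul1r.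
  by rewrite mulr_natr.
all: apply/matrixP=> i j; rewrite !mxE !in_setD1.
all: by rewrite [lift a i == a]eq_sym (negbTE (neq_lift a i)).
Qed.

(** If [x_i (M x)_i <= 0] for all [i], then on the support of [x] one can write
[(M x)_i = - d_i x_i] with [d_i >= 0], so [x] is in the kernel of [M + diag d]
masked to its support, which is nonsingular. *)
Lemma P_matrix_sign_preserving (R : realType) n (M : 'M[R]_n) :
  P_matrix M -> sign_preserving M.
Proof.
move=> PM x x0; apply/existsP; apply: contraNT x0.
rewrite negb_exists => /forallP xM.
pose I := [set i | x i 0 != 0].
pose d : 'rV[R]_n := \row_i if i \in I then - (M *m x) i 0 / x i 0 else 0.
have d0 i : 0 <= d 0 i.
  rewrite mxE inE; case: eqP => //= /eqP xi.
  have := xM i; rewrite -leNgt => xMi.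
  rewrite mulNr oppr_ge0.
  have -> : (M *m x) i 0 / x i 0 = (x i 0 * (M *m x) i 0) * (x i 0 ^- 2) by field.
  by rewrite mulr_le0_ge0 // invr_ge0 sqr_ge0.
have detM : 0 < \det (masked (M + diag_mx d) I) by exact: P_matrix_det_shift_gt0.
have unitM : masked (M + diag_mx d) I \in unitmx.
  by rewrite unitmxE unitfE gt_eqF.
apply/eqP; rewrite -[x](mulKmx unitM).
rewrite [X in _ *m X](_ : _ = 0) ?mulmx0 //.
apply/matrixP=> i j; rewrite ord1 [RHS]mxE masked_mul; case: ifP => iI.
  have -> : ((M + diag_mx d) *m x) i 0 = (M *m x) i 0 + d 0 i * x i 0.
    by rewrite mulmxDl mul_diag_mx; move: (M *m x) => y; rewrite !mxE.
  by rewrite [d 0 i]mxE iI divfK ?subrr //; rewrite inE in iI.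
by apply/eqP; move: iI; rewrite inE => /negbT; rewrite negbK.
Qed.

(** * Positive semidefinite matrices *)

Section PSD.
Context {R : realType}.

Lemma quad_form_trace m (M : 'M[R]_m) (x : 'cV[R]_m) :
  quad_form M x = \tr (M *m (x *m x^T)).
Proof. by rewrite mulmxA mxtrace_mulC mulmxA trace_mx11. Qed.

Lemma quad_form_delta m (M : 'M[R]_m) i : quad_form M (delta_mx i 0) = M i i.
Proof.
by rewrite /quad_form trmx_delta -mulmxA -colE -rowE !mxE.
Qed.

Lemma quad_formD m (M : 'M[R]_m) (x y : 'cV[R]_m) t : M^T = M ->
  quad_form M (x + t *: y) =
    quad_form M x + 2 * t * (x^T *m M *m y) 0 0 + t ^+ 2 * quad_form M y.
Proof.
move=> sM; rewrite /quad_form.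
have sw : (y^T *m M *m x) 0 0 = (x^T *m M *m y) 0 0.
  have -> : y^T *m M *m x = (x^T *m M *m y)^T.
    by rewrite !trmx_mul trmxK sM mulmxA.
  by rewrite mxE.
have -> : (x + t *: y)^T = x^T + t *: y^T by rewrite linearD linearZ.
rewrite !mulmxDl !mulmxDr -!scalemxAl -!scalemxAr.
move: sw; move: (y^T *m M *m x) (x^T *m M *m y) (x^T *m M *m x) (y^T *m M *m y).
move=> a b c d; rewrite !mxE => ->; ring.
Qed.

Lemma psd_quad2_ge0 m (S : 'M[R]_m) i j t : possemidef S ->
  0 <= S i i + 2 * t * S i j + t ^+ 2 * S j j.
Proof.
move=> [sS /(_ (delta_mx i 0 + t *: delta_mx j 0))].
rewrite quad_formD // !quad_form_delta.
by rewrite trmx_delta -mulmxA -colE -rowE !mxE.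
Qed.

Lemma psd_diag_ge0 m (S : 'M[R]_m) i : possemidef S -> 0 <= S i i.
Proof. by move=> [_ /(_ (delta_mx i 0))]; rewrite quad_form_delta. Qed.

(** When [S i i = 0], the polynomial in [t] of [psd_quad2_ge0 j i] is affine, so
its slope must vanish. *)
Lemma psd_diag0 m (S : 'M[R]_m) i j : possemidef S -> S i i = 0 -> S i j = 0.
Proof.
move=> pS Sii; apply/eqP; apply: contraT => Sij.
(* This [t] makes the affine function take the value -1. *)
have := psd_quad2_ge0 j i (- (S j j + 1) / (2 * S i j)) pS.
have -> : S j i = S i j by rewrite -{1}pS.1 mxE.
rewrite Sii mulr0 addr0.
rewrite (_ : 2 * _ * _ = - (S j j + 1)); first by lra.
by field.
Qed.

(** This bounds the set of semidefinite matrices of given trace. *)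
Lemma psd_entry_le_trace m (S : 'M[R]_m) i j :
  possemidef S -> `|S i j| <= \tr S.
Proof.
move=> pS.
have Sle k : S k k <= \tr S.
  rewrite /mxtrace (bigD1 k) //= lerDl sumr_ge0 // => l _.
  exact: psd_diag_ge0.
have := Sle i; have := Sle j.
have := psd_quad2_ge0 i j 1 pS; have := psd_quad2_ge0 i j (-1) pS.
by rewrite ler_norml; lra.
Qed.

(** Symmetric Gaussian elimination: with a pivot [S i i > 0], subtracting
[(S e_i) (S e_i)^T / S i i] leaves a semidefinite matrix with one more zero on
the diagonal; when the diagonal is zero, so is the matrix. *)
Lemma psd_gram m (S : 'M[R]_m) : possemidef S ->
  exists s : seq 'cV[R]_m, S = \sum_(v <- s) v *m v^T.
Proof.
have [k] := ubnP #|[set i | S i i != 0]|.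
elim: k S => // k IH S; rewrite ltnS => Sk pS.
have [/existsP[i Si]|] := boolP [exists i, S i i != 0]; last first.
  rewrite negb_exists => /forallP S0; exists [::]; rewrite big_nil.
  apply/matrixP=> i j; rewrite mxE; apply: psd_diag0 => //.
  by have := S0 i; rewrite negbK => /eqP.
have Sgt : 0 < S i i by rewrite lt_neqAle eq_sym Si psd_diag_ge0.
pose c := S i i; pose v : 'cV[R]_m := (Num.sqrt c)^-1 *: col i S.
have vvE j l : (v *m v^T) j l = S j i * S l i / c.
  rewrite mxE big_ord1 !mxE.
  rewrite mulrACA mulrC -invfM -expr2 sqr_sqrtr ?ltW //.
have pT : possemidef (S - v *m v^T).
  split.
    by rewrite linearB /= trmx_mul trmxK pS.1.
  (* Minimise [S] along the line through [x] in the direction [e_i]. *)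
  move=> x; pose e : 'cV[R]_m := delta_mx i 0.
  have := pS.2 (x + (- (x^T *m S *m e) 0 0 / c) *: e).
  rewrite quad_formD ?pS.1 // quad_form_delta -/c.
  have -> : quad_form (S - v *m v^T) x =
            quad_form S x - (x^T *m S *m e) 0 0 ^+ 2 / c.
    rewrite /quad_form mulmxBr mulmxBl [LHS]mxE; congr (_ + _); rewrite mxE.
    congr (- _); rewrite mulmxA -[_ *m v *m _ *m x]mulmxA.
    have -> : v^T *m x = (x^T *m v)^T by rewrite trmx_mul trmxK.
    rewrite [LHS]mxE big_ord1 [_^T 0 0]mxE -expr2.
    rewrite /v -scalemxAr colE mulmxA -/e.
    move: (x^T *m S *m e) => z; rewrite mxE exprMn exprVn.
    by rewrite sqr_sqrtr ?ltW // mulrC.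
  move: (quad_form S x) ((x^T *m S *m e) 0 0) => a b.
  have c0 : c != 0 by [].
  rewrite (_ : a + _ + _ = a - b ^+ 2 / c) //; by field.
have [|s eS] := IH (S - v *m v^T) _ pT.
  apply: leq_trans Sk; apply: proper_card; apply/properP; split.
    apply/subsetP=> j; rewrite !inE; apply: contraNN => /eqP Sj.
    rewrite [X in X == _]mxE [X in _ + X]mxE vvE Sj (psd_diag0 i pS Sj).
    by rewrite mul0r mul0r subrr.
  exists i; rewrite !inE //.
  by rewrite [X in X != _]mxE [X in _ + X]mxE vvE -/c mulfK // subrr eqxx.
by exists (v :: s); rewrite big_cons -eS addrC subrK.
Qed.

(** Along a Gram decomposition of [S] the trace is a sum of values of the
quadratic form of [N]. *)
Lemma trace_neg_psd_lt0 m (N S : 'M[R]_m) :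
  (forall x, x != 0 -> quad_form N x < 0) -> possemidef S -> S != 0 ->
  \tr (N *m S) < 0.
Proof.
move=> Nneg /psd_gram[s ->].
have tE t : \tr (N *m (\sum_(v <- t) v *m v^T)) = \sum_(v <- t) quad_form N v.
  rewrite mulmx_sumr raddf_sum /=.
  by apply: eq_bigr => v _; rewrite quad_form_trace.
have q0 : quad_form N 0 = 0 by rewrite /quad_form mulmx0 mxE.
have le0 t : \sum_(v <- t) quad_form N v <= 0.
  apply: sumr_le0 => v _; have [->|v0] := eqVneq v 0; first by rewrite q0.
  exact: ltW (Nneg _ v0).
rewrite tE; elim: s => [|v s IH]; first by rewrite big_nil eqxx.
rewrite !big_cons; have [->|v0 _] := eqVneq v 0.
  by rewrite mul0mx !add0r q0 add0r.
by apply: ltr_wnDr; [exact: le0|exact: Nneg].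
Qed.

Lemma psd_congruence m (S D : 'M[R]_m) :
  possemidef S -> possemidef (D^T *m S *m D).
Proof.
move=> [sS pS]; split; first by rewrite !trmx_mul trmxK sS mulmxA.
by move=> x; have := pS (D *m x); rewrite /quad_form trmx_mul !mulmxA.
Qed.

Lemma diag_psd m (d : 'rV[R]_m) : (forall i, 0 <= d 0 i) -> possemidef (diag_mx d).
Proof.
move=> d0; split; first exact: tr_diag_mx.
move=> x; rewrite /quad_form -mulmxA mul_diag_mx mxE sumr_ge0 // => i _.
by rewrite !mxE mulrCA mulr_ge0 // -expr2 sqr_ge0.
Qed.

Lemma psdD m (S T : 'M[R]_m) : possemidef S -> possemidef T -> possemidef (S + T).
Proof.
move=> [sS pS] [sT pT]; split; first by rewrite linearD /= sS sT.
move=> x; rewrite /quad_form mulmxDr mulmxDl mxE addr_ge0 //; [exact: pS|exact: pT].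
Qed.

Lemma psdZ m (S : 'M[R]_m) a : 0 <= a -> possemidef S -> possemidef (a *: S).
Proof.
move=> a0 [sS pS]; split; first by rewrite linearZ /= sS.
move=> x; rewrite /quad_form -scalemxAr -scalemxAl mxE mulr_ge0 //; exact: pS.
Qed.

Lemma psd_rank1 m (x : 'cV[R]_m) : possemidef (x *m x^T).
Proof.
split; first by rewrite trmx_mul trmxK.
move=> y; rewrite /quad_form mulmxA -mulmxA.
have -> : x^T *m y = (y^T *m x)^T by rewrite trmx_mul trmxK.
by rewrite mxE big_ord1 [_^T 0 0]mxE -expr2 sqr_ge0.
Qed.

End PSD.

(** * A theorem of the alternative for the semidefinite cone *)

Section NegativePart.
Context {R : realType}.

Definition negpart (r : R) : R := Num.max (- r) 0.

Lemma negpart_ge0 r : 0 <= negpart r.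
Proof. by rewrite le_max lexx orbT. Qed.

Lemma negpart_mul r : negpart r * r = - negpart r ^+ 2.
Proof. rewrite /negpart; case: (leP (- r) 0) => _; ring. Qed.

(** A one-sided second-order bound: it stands in for the derivative of the
squared negative part in the first-order optimality condition. *)
Lemma negpart_shift r h : negpart (r + h) ^+ 2 <= (negpart r - h) ^+ 2.
Proof.
rewrite {1}/negpart; case: (leP (- (r + h)) 0) => rh.
  by rewrite expr0n /= sqr_ge0.
have : - r <= negpart r by rewrite le_max lexx.
by move=> rn; rewrite ler_sqr ?nnegrE; lra.
Qed.

End NegativePart.

Section Compactness.
Import boolp classical_sets topology normedtype derive.
Import numFieldNormedType.Exports.
Local Open Scope classical_set_scope.
Context {R : realType}.

Lemma continuous_trace_vec m (F : 'M[R]_m) :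
  continuous (fun v : 'rV[R]_(m * m) => \tr (F *m vec_mx v)).
Proof.
rewrite (_ : (fun _ => _) = fun v : 'rV[R]_(m * m) =>
   \sum_i \sum_j F i j * v 0 (mxvec_index j i)); last first.
  apply/funext => v; apply: eq_bigr => i _; rewrite mxE.
  by apply: eq_bigr => j _; rewrite !mxE.
apply: continuous_big => [|i _]; first exact: add_continuous.
apply: continuous_big => [|j _]; first exact: add_continuous.
move=> v; apply: continuousM; first exact: cst_continuous.
exact: coord_continuous.
Qed.

(** Row vectors of length [m * m] encode the matrices, because the Heine-Borel
theorem is stated for row vectors. *)
Definition spectrahedron m : set 'rV[R]_(m * m) :=
  [set v | possemidef (vec_mx v) /\ \tr (vec_mx v) = 1].

(** Entries are bounded by the trace, and each defining condition is closed, as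
it compares [\tr (F *m S)], for some fixed [F], with a constant. *)
Lemma compact_spectrahedron m : compact (@spectrahedron m).
Proof.
apply: bounded_closed_compact.
  exists 1; split; first exact: num_real.
  move=> M M1 v [pv tv]; apply: le_trans (ltW M1).
  rewrite [leLHS]/Num.norm /= mx_normrE; apply/bigmax_le => [|[i j] _] /=.
    exact: ler01.
  rewrite ord1; case/mxvec_indexP: j => a b.
  by rewrite -tv; have := psd_entry_le_trace a b pv; rewrite mxE.
pose tr F (v : 'rV[R]_(m * m)) := \tr (F *m vec_mx v).
have closed_eqc F c : closed [set v | tr F v = c].
  apply: (@preimage_closed _ _ (tr F) [set x | x = c]); last exact: closed_eq.
  by move=> v _; exact: continuous_trace_vec.
have closed_ge0 F : closed [set v | 0 <= tr F v].
  apply: (@preimage_closed _ _ (tr F) [set x | 0 <= x]); last exact: closed_ge.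
  by move=> v _; exact: continuous_trace_vec.
have -> : @spectrahedron m =
   (\bigcap_(x in [set: 'cV[R]_m]) [set v | 0 <= tr (x *m x^T) v])
   `&` ((\bigcap_(ij in [set: 'I_m * 'I_m])
       [set v | tr (delta_mx ij.2 ij.1 - delta_mx ij.1 ij.2) v = 0])
   `&` [set v | tr 1%:M v = 1]).
  have dE (S : 'M[R]_m) i j : \tr (delta_mx j i *m S) = S i j.
    rewrite /mxtrace (bigD1 j) //= big1 ?addr0 => [|k kj].
      rewrite mxE (bigD1 i) //= big1 ?addr0 => [|k ki].
        by rewrite mxE !eqxx mul1r.
      by rewrite mxE eqxx (negbTE ki) mul0r.
    by rewrite mxE big1 // => l _; rewrite mxE (negbTE kj) mul0r.
  apply/seteqP; split => [v [[sv pv] tv]|v [pv [sv tv]]].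
    split; first by move=> x _ /=; rewrite /tr mxtrace_mulC -quad_form_trace.
    split; last by rewrite /= /tr mul1mx.
    move=> [i j] _ /=; rewrite /tr mulmxBl linearB /= !dE.
    by rewrite -[in X in _ - X]sv [X in _ - X]mxE subrr.
  split; last by move: tv; rewrite /= /tr mul1mx.
  split.
    apply/matrixP=> i j; have := sv (j, i) I; rewrite /= /tr mulmxBl linearB /= !dE.
    by move/eqP; rewrite subr_eq0 => /eqP <-; rewrite mxE.
  by move=> x; have := pv x I; rewrite /= /tr mxtrace_mulC -quad_form_trace.
apply: closedI; first by apply: closed_bigI => x _; exact: closed_ge0.
apply: closedI; last exact: closed_eqc.
by apply: closed_bigI => x _; exact: closed_eqc.
Qed.

(** The minimised function vanishes exactly when all the inequalities
[0 <= \tr (F i *m S)] hold. *)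
Lemma spectrahedron_min m (I : finType) (F : I -> 'M[R]_m) : (0 < m)%N ->
  exists S : 'M[R]_m, [/\ possemidef S, \tr S = 1 &
    forall T, possemidef T -> \tr T = 1 ->
      \sum_i negpart (\tr (F i *m S)) ^+ 2 <= \sum_i negpart (\tr (F i *m T)) ^+ 2].
Proof.
move=> m0.
pose phi (v : 'rV[R]_(m * m)) := \sum_i negpart (\tr (F i *m vec_mx v)) ^+ 2.
have cphi : continuous phi.
  apply: continuous_big => [|i _]; first exact: add_continuous.
  have cn : continuous (fun v : 'rV[R]_(m * m) => negpart (\tr (F i *m vec_mx v))).
    move=> v; apply: (@continuous_max _ _ (fun u => - \tr (F i *m vec_mx u)) (fun=> 0)).
      by apply: continuousN; exact: continuous_trace_vec.
    exact: cst_continuous.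
  pose g (v : 'rV[R]_(m * m)) := negpart (\tr (F i *m vec_mx v)).
  by move=> v; apply: (@continuousM _ _ g g v); exact: cn.
have [|v] := compact_EVT_min _ (@compact_spectrahedron m) (continuous_subspaceT cphi).
  pose e : 'cV[R]_m := delta_mx (Ordinal m0) 0.
  exists (mxvec (e *m e^T)).
  rewrite /spectrahedron /= mxvecK; split; first exact: psd_rank1.
  rewrite mxtrace_mulC trmx_delta mul_delta_mx trace_mx11.
  by rewrite mxE !eqxx.
rewrite inE => -[pv tv] vmin; exists (vec_mx v); split => // T pT tT.
have := vmin (mxvec T); rewrite /phi mxvecK; apply.
by rewrite inE /spectrahedron /= mxvecK.
Qed.

End Compactness.

Section Alternative.
Context {R : realType}.

(** Gordan's alternative for the semidefinite cone.  Let [S] minimise the sum of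
the squares of the negative parts of the [\tr (F i *m S)], with minimum [mu],
and let [w i] be these negative parts.  If [mu > 0], optimality on the segments
issued from [S] gives [\sum_i w i * \tr (F i *m T) <= - mu] for every
semidefinite [T] of trace 1.  As the traces are bounded there, the [w i] can
all be increased a little to become positive; rank-one [T] then give the
quadratic forms. *)
Lemma psd_gordan m (I : finType) (F : I -> 'M[R]_m) :
  (exists S, [/\ possemidef S, \tr S = 1 & forall i, 0 <= \tr (F i *m S)]) \/
  (exists p : I -> R, (forall i, 0 < p i) /\
     forall x, x != 0 -> \sum_i p i * quad_form (F i) x < 0).
Proof.
have [m0|m0] := posnP m.
  right; exists (fun=> 1); split=> [i|x]; first exact: ltr01.
  by move=> /cvN0_entry[i]; have := ltn_ord i; rewrite [X in (_ < X)%N]m0.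
have [S [pS tS Smin]] := spectrahedron_min F m0.
pose a i := \tr (F i *m S); pose w i := negpart (a i).
have [/forallP aS|] := boolP [forall i, 0 <= a i]; first by left; exists S.
rewrite negb_forall => /existsP[i0]; rewrite -ltNge => ai0; right.
pose mu := \sum_i w i ^+ 2.
have mu0 : 0 < mu.
  rewrite /mu (bigD1 i0) //= ltr_wpDr ?sumr_ge0 // => [i _|]; first exact: sqr_ge0.
  rewrite exprn_even_gt0 //= gt_eqF // lt_max; apply/orP; left; lra.
have opt T : possemidef T -> \tr T = 1 -> \sum_i w i * \tr (F i *m T) <= - mu.
  move=> pT tT; pose d i := \tr (F i *m T) - a i.
  suff wd : \sum_i w i * d i <= 0.
    have -> : - mu = \sum_i w i * a i.
      by rewrite -sumrN; apply: eq_bigr => i _; rewrite negpart_mul.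
    rewrite -subr_le0 -sumrB; apply: le_trans wd; rewrite le_eqVlt; apply/orP; left.
    by apply/eqP; apply: eq_bigr => i _; rewrite mulrBr.
  pose c := \sum_i w i * d i; pose D := \sum_i d i ^+ 2.
  have D0 : 0 <= D by apply: sumr_ge0 => i _; exact: sqr_ge0.
  have step t : 0 <= t <= 1 -> 2 * t * c <= t ^+ 2 * D.
    move=> /andP[t0 t1].
    have := Smin ((1 - t) *: S + t *: T).
    have -> : \tr ((1 - t) *: S + t *: T) = 1.
      by rewrite mxtraceD !mxtraceZ tS tT; ring.
    move=> /(_ _ erefl) min_t.
    have {min_t} : mu <= \sum_i (w i - t * d i) ^+ 2.
      apply: le_trans (min_t _) _.
        by apply: psdD; apply: psdZ => //; rewrite subr_ge0.
      apply: ler_sum => i _.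
      have -> : \tr (F i *m ((1 - t) *: S + t *: T)) = a i + t * d i.
        rewrite mulmxDr mxtraceD -!scalemxAr !mxtraceZ -/(a i) /d; ring.
      exact: negpart_shift.
    have -> : \sum_i (w i - t * d i) ^+ 2 = mu + (t ^+ 2 * D - 2 * t * c).
      rewrite /mu /D /c !mulr_sumr -sumrB -big_split /=.
      by apply: eq_bigr => i _; ring.
    lra.
  rewrite leNgt; apply/negP; rewrite -/c => c0.
  have cD : 0 < c + D by lra.
  (* A step [k] in [0, 1] at which the linear gain [2 * k * c] exceeds the
     quadratic loss [k ^+ 2 * D]. *)
  pose k := c / (c + D).
  have k0 : 0 < k by exact: divr_gt0.
  have kD : k * D = c - k * c by rewrite -[c in c - _](divfK (lt0r_neq0 cD)) -/k; ring.
  have k1 : 0 <= k <= 1 by rewrite (ltW k0) /k ler_pdivrMr // mul1r; lra.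
  have := step k k1; rewrite expr2 -[k * k * D]mulrA kD.
  have := mulr_gt0 k0 c0; have := mulr_gt0 k0 (mulr_gt0 k0 c0); lra.
pose C := \sum_i \sum_k \sum_l `|F i k l|.
have C0 : 0 <= C by do 3 (apply: sumr_ge0 => ? _).
have bound T : possemidef T -> \tr T = 1 -> \sum_i \tr (F i *m T) <= C.
  move=> pT tT; apply: ler_sum => i _; apply: ler_sum => k _; rewrite mxE.
  apply: ler_sum => l _; apply: le_trans (ler_norm _) _.
  by rewrite normrM ler_piMr // -tT psd_entry_le_trace.
(* Chosen so that [eps * C < mu]. *)
pose eps := mu / (1 + C).
have eps0 : 0 < eps by apply: divr_gt0 => //; lra.
exists (fun i => w i + eps); split.
  by move=> i; rewrite ltr_wpDl // negpart_ge0.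
move=> x x0.
have xx : 0 < (x^T *m x) 0 0.
  have [j xj] := cvN0_entry x0.
  rewrite mxE (bigD1 j) //= mxE -expr2 ltr_wpDr ?exprn_even_gt0 //.
  by apply: sumr_ge0 => i _; rewrite mxE -expr2 sqr_ge0.
set r := (x^T *m x) 0 0 in xx.
pose T := r^-1 *: (x *m x^T).
have pT : possemidef T by apply: psdZ (psd_rank1 x); rewrite invr_ge0 ltW.
have tT : \tr T = 1.
  by rewrite mxtraceZ mxtrace_mulC trace_mx11 mulVf // gt_eqF.
have qT i : quad_form (F i) x = r * \tr (F i *m T).
  by rewrite quad_form_trace /T -scalemxAr mxtraceZ mulVKf // gt_eqF.
have -> : \sum_i (w i + eps) * quad_form (F i) x =
    r * (\sum_i w i * \tr (F i *m T) + eps * \sum_i \tr (F i *m T)).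
  rewrite mulr_sumr -big_split mulr_sumr /=.
  by apply: eq_bigr => i _; rewrite qT; ring.
rewrite pmulr_rlt0 //.
apply: le_lt_trans (_ : - mu + eps * C < 0).
  by apply: lerD; [exact: opt|rewrite ler_pM2l //; exact: bound].
rewrite addrC subr_lt0 /eps mulrAC ltr_pdivrMr; last by lra.
by rewrite mulrDr mulr1 ltrDr.
Qed.

End Alternative.

(** * The Riccati inequality as a block inequality *)

Section PosDef.
Context {R : realType} {n : nat}.

Lemma posdef_diag_gt0 (P : 'M[R]_n) i : posdef P -> 0 < P i i.
Proof.
move=> [_ /(_ (delta_mx i 0))]; rewrite quad_form_delta; apply.
by apply/eqP => /matrixP /(_ i 0); rewrite !mxE !eqxx => /eqP; rewrite oner_eq0.
Qed.

Lemma diag_posdef (d : 'rV[R]_n) : (forall i, 0 < d 0 i) -> posdef (diag_mx d).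
Proof.
move=> d0; split; first exact: tr_diag_mx.
move=> x /cvN0_entry[i xi]; rewrite /quad_form -mulmxA mul_diag_mx mxE.
rewrite (bigD1 i) //= !mxE mulrCA -expr2 ltr_wpDr //.
  apply: sumr_ge0 => j _; rewrite !mxE mulrCA -expr2.
  by rewrite mulr_ge0 ?sqr_ge0 ?ltW.
by rewrite mulr_gt0 // exprn_even_gt0.
Qed.

Lemma posdef_unitmx (Q : 'M[R]_n) : posdef Q -> Q \in unitmx.
Proof.
move=> [_ pQ]; rewrite unitmxE unitfE; apply/eqP => /det0_kernel[x x0 Qx].
by have := pQ x x0; rewrite /quad_form -mulmxA Qx mulmx0 mxE ltxx.
Qed.

End PosDef.

Section Riccati.
Context {R : realType} {n : nat} (A B : 'M[R]_n).

Definition riccati_block (P Q : 'M[R]_n) : 'M[R]_(n + n) :=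
  block_mx (A^T *m P + P *m A + Q) (P *m B) (B^T *m P) (- Q).

(** Completing the square in [y]. *)
Lemma riccati_block_schur (P Q : 'M[R]_n) (x y : 'cV[R]_n) :
  P^T = P -> Q^T = Q -> Q \in unitmx ->
  quad_form (riccati_block P Q) (col_mx x y) =
    quad_form (A^T *m P + P *m A + Q + P *m B *m invmx Q *m B^T *m P) x
    - quad_form Q (y - invmx Q *m B^T *m P *m x).
Proof.
move=> sP sQ uQ; rewrite /quad_form tr_col_mx.
rewrite mul_row_block mul_row_col.
set z := invmx Q *m B^T *m P *m x.
have zT : z^T = x^T *m P *m B *m invmx Q.
  by rewrite !trmx_mul trmxK sP trmx_inv sQ !mulmxA.
have Qz : Q *m z = B^T *m P *m x by rewrite /z !mulmxA mulmxV // mul1mx.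
have zQ : z^T *m Q = x^T *m P *m B by rewrite zT mulmxKV.
set W := A^T *m P + P *m A + Q.
have -> : (y - z)^T = y^T - z^T by rewrite linearB.
rewrite mulmxBl zQ mulmxBr !mulmxBl -(mulmxA _ Q z) Qz.
have -> : x^T *m P *m B *m z = x^T *m (P *m B *m invmx Q *m B^T *m P) *m x.
  by rewrite /z !mulmxA.
rewrite mulmxN !mulmxDl !mulmxDr !mulmxDl !mulmxA !mulNmx.
rewrite /W.
move: (x^T *m A^T *m P *m x) => a1.
move: (_ *m invmx Q *m _ *m _ *m x) (x^T *m P *m A *m x) (x^T *m Q *m x) => a2 a3 a4.
move: (_ *m y) (y^T *m B^T *m P *m x) (x^T *m P *m B *m y) => a5 a6 a7.
rewrite !mxE; ring.
Qed.

(** The square completed in [riccati_block_schur] vanishes at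
[y = Q^-1 B^T P x], which recovers the Riccati form; elsewhere it only helps. *)
Lemma negdef_riccati_block (P Q : 'M[R]_n) :
  P^T = P -> posdef Q ->
  negdef (A^T *m P + P *m A + Q + P *m B *m invmx Q *m B^T *m P) <->
  (forall z, z != 0 -> quad_form (riccati_block P Q) z < 0).
Proof.
move=> sP pQ; have uQ := posdef_unitmx pQ; have [sQ Qgt] := pQ.
have quad0 (M : 'M[R]_n) : quad_form M 0 = 0 by rewrite /quad_form mulmx0 mxE.
split=> [[_ neg] z | neg].
  rewrite -[z]vsubmxK; move: (usubmx z) (dsubmx z) => x y xy.
  rewrite riccati_block_schur //.
  have [x0|x0] := eqVneq x 0.
    rewrite x0 mulmx0 subr0 quad0 add0r oppr_lt0; apply: Qgt.
    by apply: contraNneq xy => ->; rewrite x0 col_mx0.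
  set w := y - _; have [->|w0] := eqVneq w 0; first by rewrite quad0 subr0 neg.
  by have := neg x x0; have := Qgt w w0; lra.
split.
  have trD (X Y : 'M[R]_n) : (X + Y)^T = X^T + Y^T by exact: linearD.
  rewrite !trD !trmx_mul !trmxK trmx_inv sP sQ !mulmxA.
  by rewrite [P *m A + _]addrC.
move=> x x0; have := neg (col_mx x (invmx Q *m B^T *m P *m x)).
rewrite riccati_block_schur // subrr quad0 subr0; apply.
by apply: contraNneq x0 => /eqP; rewrite col_mx_eq0 => /andP[].
Qed.

Lemma trace_diag_mul (d : 'rV[R]_n) (X : 'M[R]_n) :
  \tr (diag_mx d *m X) = \sum_i d 0 i * X i i.
Proof. by apply: eq_bigr => i _; rewrite mul_diag_mx mxE. Qed.

(** The Hadamard products enter here: the diagonal of [A *m S11 + B *m S12^T]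
consists of the row sums of [hadamard A S11 + hadamard B S12]. *)
Lemma trace_riccati_block (p q : 'rV[R]_n) (S11 S12 S22 : 'M[R]_n) :
  S11^T = S11 ->
  \tr (riccati_block (diag_mx p) (diag_mx q) *m block_mx S11 S12 S12^T S22) =
  \sum_i p 0 i * (2 * \sum_j (hadamard A S11 + hadamard B S12) i j)
  + \sum_i q 0 i * (S11 i i - S22 i i).
Proof.
move=> s11; rewrite /riccati_block mulmx_block mxtrace_block.
set P := diag_mx p; set Q := diag_mx q.
have h1 : \tr (A^T *m P *m S11) = \tr (P *m (A *m S11)).
  rewrite -mxtrace_tr !trmx_mul trmxK s11 tr_diag_mx.
  by rewrite mxtrace_mulC -mulmxA.
have h2 : \tr (B^T *m P *m S12) = \tr (P *m (B *m S12^T)).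
  rewrite -mxtrace_tr !trmx_mul trmxK tr_diag_mx.
  by rewrite mxtrace_mulC -mulmxA.
rewrite !mulmxDl !mxtraceD h1 h2 mulNmx raddfN /= -!mulmxA !trace_diag_mul.
rewrite -sumrN -!big_split /=.
apply: eq_bigr => i _.
have -> : \sum_j (hadamard A S11 + hadamard B S12) i j
   = (A *m S11) i i + (B *m S12^T) i i.
  rewrite !mxE -big_split /=; apply: eq_bigr => j _; rewrite !mxE.
  by rewrite -{1}s11 mxE.
ring.
Qed.

(** * Stability and the sign property *)

Lemma mulNmx_entry (M : 'M[R]_n) (x : 'cV[R]_n) i :
  (- M *m x) i 0 = - (M *m x) i 0.
Proof. by rewrite mulNmx mxE. Qed.

Lemma hadamard_sum_entry (S T : 'M[R]_n) i j :
  (hadamard A S + hadamard B T) i j = A i j * S i j + B i j * T i j.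
Proof. by rewrite !mxE. Qed.

(** Pair the negative definite block matrix with the congruence of [S] by
[diag(x, x)], whose row sums are the [x_i (T(S) x)_i]. *)
Lemma stable_sign_preserving (S11 S12 S22 : 'M[R]_n) :
  diag_riccati_stable A B ->
  possemidef (block_mx S11 S12 S12^T S22) ->
  diag_vec S11 = diag_vec S22 -> vec_gt (diag_vec S22) 0 ->
  sign_preserving (- (hadamard A S11 + hadamard B S12)).
Proof.
move=> [P [Q [dP pP dQ pQ neg]]] pS dS Sgt x x0.
have [P' eP] := diag_mxP _ dP; have [Q' eQ] := diag_mxP _ dQ.
have sS : S11^T = S11.
  by have := pS.1; rewrite tr_block_mx => /eq_block_mx[].
pose X := diag_mx x^T; pose T11 := X *m S11 *m X; pose T12 := X *m S12 *m X.
pose T22 := X *m S22 *m X.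
have XE (S : 'M[R]_n) i j : (X *m S *m X) i j = x i 0 * S i j * x j 0.
  by rewrite mul_mx_diag mul_diag_mx !mxE.
have T12T : T12^T = X *m S12^T *m X by rewrite !trmx_mul tr_diag_mx mulmxA.
have pT : possemidef (block_mx T11 T12 T12^T T22).
  have -> : block_mx T11 T12 T12^T T22 =
     (block_mx X 0 0 X)^T *m block_mx S11 S12 S12^T S22 *m block_mx X 0 0 X.
    rewrite tr_block_mx !trmx0 tr_diag_mx !mulmx_block T12T.
    by rewrite !(mul0mx, mulmx0, addr0, add0r).
  exact: psd_congruence.
have sT : T11^T = T11 by rewrite !trmx_mul tr_diag_mx sS mulmxA.
have dT i : T11 i i = T22 i i.
  by rewrite !XE; have /matrixP/(_ i 0) := dS; rewrite !mxE => ->.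
have Tneq0 : block_mx T11 T12 T12^T T22 != 0.
  have [i xi] := cvN0_entry x0.
  apply/eqP=> /matrixP/(_ (rshift _ i) (rshift _ i)).
  rewrite block_mxEdr XE mxE => /eqP.
  have := Sgt i; rewrite !mxE => Si.
  by rewrite !mulf_eq0 (negbTE xi) (gt_eqF Si).
have := trace_neg_psd_lt0 ((negdef_riccati_block pP.1 pQ).1 neg) pT Tneq0.
rewrite eP eQ trace_riccati_block //.
rewrite [X in _ + X]big1 ?addr0 => [|i _]; last by rewrite dT subrr mulr0.
move=> sum_lt0; apply/existsP; apply: contraTT sum_lt0.
rewrite negb_exists => /forallP xM; rewrite -leNgt.
apply: sumr_ge0 => i _.
have := posdef_diag_gt0 i pP; rewrite eP !mxE eqxx mulr1n => Pi.
rewrite mulr_ge0 ?(ltW Pi) // mulr_ge0 //.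
have := xM i; rewrite -leNgt mulNmx_entry mulrN oppr_le0.
congr (0 <= _); rewrite mxE mulr_sumr; apply: eq_bigr => j _.
rewrite !hadamard_sum_entry !XE; ring.
Qed.

Lemma sum_delta_row (i : 'I_n) (f : 'I_n -> R) :
  \sum_k (delta_mx 0 i : 'rV[R]_n) 0 k * f k = f i.
Proof.
rewrite (bigD1 i) //= mxE !eqxx mul1r big1 ?addr0 // => k ki.
by rewrite mxE (negbTE ki) andbF mul0r.
Qed.

Lemma sum_zero_row (f : 'I_n -> R) : \sum_k (0 : 'rV[R]_n) 0 k * f k = 0.
Proof. by apply: big1 => k _; rewrite mxE mul0r. Qed.

(** The multipliers of the alternative applied to the coefficients of the [p_i]
and [q_i] in [riccati_block] are the diagonals of [P] and [Q].  In the other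
case, the matrix [S] it gives is corrected to have equal positive diagonals,
and contradicts the sign property at the indicator of the support of the
diagonal of [S11]. *)
Lemma stable_of_sign_preserving :
  (forall S11 S12 S22 : 'M[R]_n,
     possemidef (block_mx S11 S12 S12^T S22) ->
     diag_vec S11 = diag_vec S22 -> vec_gt (diag_vec S22) 0 ->
     sign_preserving (- (hadamard A S11 + hadamard B S12))) ->
  diag_riccati_stable A B.
Proof.
move=> HS.
pose F (i : 'I_n + 'I_n) := match i with
  | inl i => riccati_block (diag_mx (delta_mx 0 i)) (diag_mx 0)
  | inr i => riccati_block (diag_mx 0) (diag_mx (delta_mx 0 i)) end.
have FlE i (S11 S12 S22 : 'M[R]_n) : S11^T = S11 ->
    \tr (F (inl i) *m block_mx S11 S12 S12^T S22) =
    2 * \sum_j (hadamard A S11 + hadamard B S12) i j.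
  by move=> s11; rewrite trace_riccati_block // sum_delta_row sum_zero_row addr0.
have FrE i (S11 S12 S22 : 'M[R]_n) : S11^T = S11 ->
    \tr (F (inr i) *m block_mx S11 S12 S12^T S22) = S11 i i - S22 i i.
  by move=> s11; rewrite trace_riccati_block // sum_delta_row sum_zero_row add0r.
suff [p [p0 pneg]] : exists p : 'I_n + 'I_n -> R, (forall i, 0 < p i) /\
     forall z, z != 0 -> \sum_i p i * quad_form (F i) z < 0.
  pose P := \row_i p (inl i); pose Q := \row_i p (inr i).
  have pP : posdef (diag_mx P) by apply: diag_posdef => i; rewrite mxE.
  have pQ : posdef (diag_mx Q) by apply: diag_posdef => i; rewrite mxE.
  exists (diag_mx P), (diag_mx Q); split=> //; try exact: diag_mx_is_diag.
  apply/(negdef_riccati_block pP.1 pQ) => z z0.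
  apply: le_lt_trans (pneg z z0); rewrite le_eqVlt; apply/orP; left; apply/eqP.
  have [x [y ->]] : exists x y, z = col_mx x y.
    by exists (usubmx z), (dsubmx z); rewrite vsubmxK.
  have zz : col_mx x y *m (col_mx x y)^T =
      block_mx (x *m x^T) (x *m y^T) (x *m y^T)^T (y *m y^T).
    by rewrite tr_col_mx mul_col_row trmx_mul trmxK.
  have sxx : (x *m x^T)^T = x *m x^T by rewrite trmx_mul trmxK.
  under [RHS]eq_bigr do rewrite quad_form_trace zz.
  rewrite quad_form_trace zz trace_riccati_block // big_sumType /=.
  congr (_ + _); apply: eq_bigr => i _; first by rewrite FlE // mxE.
  by rewrite FrE // mxE.
case: (psd_gordan F) => // -[S [pS tS FS]]; exfalso.
move: pS tS FS; rewrite -[S]submxK.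
move: (ulsubmx S) (ursubmx S) (dlsubmx S) (drsubmx S) => S11 S12 S21 S22 pS tS FS.
have [s11 s12 s22] : [/\ S11^T = S11, S21 = S12^T & S22^T = S22].
  by have := pS.1; rewrite tr_block_mx => /eq_block_mx[? ? <- ?].
rewrite {}s12 in pS tS FS.
have rowsum i : 0 <= \sum_j (hadamard A S11 + hadamard B S12) i j.
  by have := FS (inl i); rewrite FlE // pmulr_rge0.
have diag_le i : S22 i i <= S11 i i.
  by have := FS (inr i); rewrite FrE // subr_ge0.
have S11_ge0 i : 0 <= S11 i i.
  by have := psd_diag_ge0 (lshift n i) pS; rewrite block_mxEul.
pose x : 'cV[R]_n := \col_i (S11 i i != 0)%:R.
(* [d1] fills the zero entries of both diagonals, and [d2] lifts the diagonal of
   [S22] to that of [S11]; [S12] and the off-diagonal entries of [S11] are left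
   alone. *)
pose d1 : 'rV[R]_n := \row_i (S11 i i == 0)%:R.
pose d2 : 'rV[R]_n := \row_i (S11 i i - S22 i i).
have pD : possemidef (diag_mx (row_mx d1 (d1 + d2))).
  apply: diag_psd => i; rewrite mxE; case: (split i) => k; rewrite !mxE ?ler0n //.
  by rewrite addr_ge0 ?ler0n // subr_ge0.
have := psdD pS pD.
rewrite diag_mx_row add_block_mx !addr0 => pT.
have [|||i] := HS _ _ _ pT _ _ x.
- apply/matrixP=> i j; rewrite !mxE eqxx !mulr1n; ring.
- move=> i; rewrite !mxE eqxx !mulr1n.
  rewrite [X in _ < X](_ : _ = S11 i i + (S11 i i == 0)%:R); last by ring.
  case: eqP => [->|/eqP Si]; first by rewrite add0r ltr01.
  by rewrite addr0 lt_neqAle eq_sym Si S11_ge0.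
- apply: contra_eq_neq tS => x0.
  have S0 i : S11 i i = 0.
    have /matrixP/(_ i 0) := x0; rewrite !mxE.
    by case: eqP => // _ /eqP; rewrite oner_eq0.
  have t11 : \tr S11 = 0 by apply: big1 => i _; exact: S0.
  have t22 : \tr S22 = 0.
    apply: big1 => i _; apply/eqP; rewrite eq_le -{1}(S0 i) diag_le.
    by have := psd_diag_ge0 (rshift n i) pS; rewrite block_mxEdr.
  by rewrite mxtrace_block t11 t22 addr0 eq_sym oner_eq0.
rewrite ltNge => /negP; apply.
rewrite [X in X * _]mxE; case: eqP => [_|/eqP Si]; first by rewrite mul0r.
rewrite mul1r mulNmx_entry oppr_le0.
have -> : ((hadamard A (S11 + diag_mx d1) + hadamard B S12) *m x) i 0 =
    \sum_j (hadamard A S11 + hadamard B S12) i j; last exact: rowsum.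
rewrite mxE; apply: eq_bigr => j _; rewrite !hadamard_sum_entry.
have -> : (S11 + diag_mx d1) i j = S11 i j.
  by rewrite !mxE (negbTE Si) mul0rn addr0.
rewrite [x j 0]mxE; have [Sj|Sj] := eqVneq (S11 j j) 0; last by rewrite mulr1.
(* Columns outside the support of [x] vanish in [S11] and [S12], hence
   contribute nothing to the row sum. *)
have S22j : S22 j j = 0.
  apply/eqP; rewrite eq_le -{1}Sj diag_le.
  by have := psd_diag_ge0 (rshift n j) pS; rewrite block_mxEdr.
have := psd_diag0 (i := lshift n j) (lshift n i) pS.
rewrite !block_mxEul => /(_ Sj) S11j.
have := psd_diag0 (i := rshift n j) (lshift n i) pS.
rewrite block_mxEdr block_mxEdl mxE => /(_ S22j) ->.
by rewrite -s11 mxE S11j !mulr0 addr0.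
Qed.

End Riccati.

Theorem theorem2p2 (R : realType) (n : nat) (A B : 'M[R]_n) :
  diag_riccati_stable A B <->
  (forall S11 S12 S22 : 'M[R]_n,
     possemidef (block_mx S11 S12 S12^T S22) ->
     diag_vec S11 = diag_vec S22 ->
     vec_gt (diag_vec S22) 0 ->
     P_matrix (- (hadamard A S11 + hadamard B S12))).
Proof.
split=> [stab S11 S12 S22 pS dS Sgt | HP].
  exact: sign_preserving_P_matrix (stable_sign_preserving stab pS dS Sgt).
apply: stable_of_sign_preserving => S11 S12 S22 pS dS Sgt.
exact: P_matrix_sign_preserving (HP S11 S12 S22 pS dS Sgt).
Qed.
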